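(* Assume (A1)–(A3). Consider mini-batch SGD with constant batch size $b_t=b$ for all $t$ and nonincreasing learning rates $\eta_{t+1}\le\eta_t$, with $\eta_t\in[\eta_{\min},\eta_{\max}]\subset[0,\frac2{\bar L})$ and $\sum_{t=0}^{T-1}\eta_t\ne0$. Then for all $T\in\mathbb N$, $$\min_{t\in[0:T-1]}\mathbb E\big[\|\nabla f(\theta_t)\|^2\big]\le\frac{2(f(\theta_0)-\underline f^\star)}{2-\bar L\eta_{\max}}B_T+\frac{\bar L\sigma^2}{2-\bar L\eta_{\max}}V_T,\qquad B_T=\frac{1}{\sum_{t=0}^{T-1}\eta_t},\quad V_T=\frac{\sum_{t=0}^{T-1}\eta_t^2}{b\sum_{t=0}^{T-1}\eta_t},$$ and, for the following learning rate schedules (with $p>0$, $E\in\mathbb N$, $K=\lceil n/b\rceil$, $0\le\eta_{\min}\le\eta_{\max}$, and $T=KE$ in the cosine case): (Constant) $\eta_t=\eta_{\max}$: $B_T\le\frac1{\eta_{\max}T}$, $V_T\le\frac{\eta_{\max}}{b}$; (Diminishing) $\eta_t=\frac{\eta_{\max}}{\sqrt{t+1}}$: $B_T\le\frac1{2\eta_{\max}(\sqrt{T+1}-1)}$, $V_T\le\frac{\eta_{\max}(1+\log T)}{2b(\sqrt{T+1}-1)}$; (Cosine) $\eta_t=\eta_{\min}+\frac{\eta_{\max}-\eta_{\min}}2\big(1+\cos\big(\lfloor t/K\rfloor\frac{\pi}{E}\big)\big)$: $B_T\le\frac2{(\eta_{\min}+\eta_{\max})T}$, $V_T\le\frac{3\eta_{\min}^2+2\eta_{\min}\eta_{\max}+3\eta_{\max}^2}{4(\eta_{\min}+\eta_{\max})b}+\frac{(\eta_{\max}-\eta_{\min})K}{bT}$;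 (Polynomial) $\eta_t=(\eta_{\max}-\eta_{\min})(1-\frac tT)^p+\eta_{\min}$: $B_T\le\frac{p+1}{(p\eta_{\min}+\eta_{\max})T}$, $V_T\le\frac{2p^2\eta_{\min}^2+2p\eta_{\min}\eta_{\max}+(p+1)\eta_{\max}^2}{(2p+1)(p\eta_{\min}+\eta_{\max})b}+\frac{(p+1)(\eta_{\max}^2-\eta_{\min}^2)}{(p\eta_{\min}+\eta_{\max})bT}$.
   Context: Let $n,d\in\mathbb N$, $f_1,\dots,f_n:\mathbb R^d\to\mathbb R$, $f=\frac1n\sum_{i=1}^nf_i$. (A1) each $f_i$ is differentiable and $L_i$-smooth ($\nabla f_i$ is $L_i$-Lipschitz, $L_i>0$), and $f_i^\star:=\inf_\theta f_i(\theta)\in\mathbb R$. (A2) $\xi$ is a random variable independent of $\theta$, and the stochastic gradient $\nabla f_\xi$ satisfies $\mathbb E_\xi[\nabla f_\xi(\theta)]=\nabla f(\theta)$ and $\mathbb E_\xi\|\nabla f_\xi(\theta)-\nabla f(\theta)\|^2\le\sigma^2$ for all $\theta$, some $\sigma\ge0$. (A3) for batch size $b$, $(\xi_1,\dots,\xi_b)$ are i.i.d. copies of $\xi$ independent of $\theta$, and $\nabla f_B(\theta)=\frac1b\sum_{i=1}^b\nabla f_{\xi_i}(\theta)$. Mini-batch SGD: from $\theta_0\in\mathbb R^d$, at step $t$ draw $\xi_t=(\xi_{t,1},\dots,\xi_{t,b_t})$ as in (A3), independent of $\theta_t$ and of earlier draws, and set $\theta_{t+1}=\theta_t-\eta_t\frac1{b_t}\sum_{i=1}^{b_t}\nabla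 f_{\xi_{t,i}}(\theta_t)$. $\mathbb E$ is total expectation. $\bar L=\frac1n\sum_iL_i$, $\underline f^\star=\frac1n\sum_if_i^\star$, $[0:N]=\{0,\dots,N\}$, $n$ is the number of training samples. *)

(* Defs.v *)
From HB Require Import structures.
From mathcomp Require Import all_boot all_order all_algebra.
From mathcomp Require Import all_classical all_reals all_analysis.
Set Implicit Arguments. Unset Strict Implicit. Unset Printing Implicit Defensive.
Import Order.TTheory GRing.Theory Num.Theory.
Import numFieldNormedType.Exports.
Local Open Scope classical_set_scope.
Local Open Scope ring_scope.

Section Defs.
Variable R : realType.

Definition dotv d (u v : 'rV[R]_d) : R := \sum_(j < d) u ord0 j * v ord0 j.
Definition sqnorm d (v : 'rV[R]_d) : R := \sum_(j < d) (v ord0 j) ^+ 2.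
Definition enorm d (v : 'rV[R]_d) : R := Num.sqrt (sqnorm v).

(* coordinates R^d encoded as a d-tuple, carrying the product (= Borel)
   sigma-algebra; used only to state joint measurability *)
Definition rv_of_tuple d (t : d.-tuple R) : 'rV[R]_d := \row_(j < d) tnth t j.

Definition avg_fun n d (fs : 'I_n -> 'rV[R]_d -> R) (x : 'rV[R]_d) : R :=
  n%:R^-1 * \sum_(i < n) fs i x.
Definition avg_grad n d (gs : 'I_n -> 'rV[R]_d -> 'rV[R]_d) (x : 'rV[R]_d)
  : 'rV[R]_d := n%:R^-1 *: \sum_(i < n) gs i x.
Definition avg_const n (c : 'I_n -> R) : R := n%:R^-1 * \sum_(i < n) c i.

Definition fstar d (g : 'rV[R]_d -> R) : R := inf (range g).

Fixpoint sgd_iter (Xi : Type) d (G : Xi -> 'rV[R]_d -> 'rV[R]_d)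
    (eta : nat -> R) (b : nat) (theta0 : 'rV[R]_d) (xi : nat -> seq Xi)
    (t : nat) : 'rV[R]_d :=
  match t with
  | 0 => theta0
  | t'.+1 => let th := sgd_iter G eta b theta0 xi t' in
             th - (eta t' * b%:R^-1) *: \sum_(x <- xi t') G x th
  end.

(* integral w.r.t. k i.i.d. draws from mu (the product measure mu^k,
   as an iterated integral) *)
Fixpoint iid_int dX (Xi : measurableType dX) (mu : probability Xi R) (k : nat)
    (h : seq Xi -> \bar R) : \bar R :=
  match k with
  | 0 => h [::]
  | k'.+1 => (\int[mu]_x iid_int mu k' (fun s => h (x :: s)))%E
  end.

Definition shift_draws (Xi : Type) (xs : seq Xi) (ys : nat -> seq Xi) :
  nat -> seq Xi := fun t => if t is t'.+1 then ys t' else xs.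

(* total expectation of a functional of the first t batches, which are
   i.i.d. batches of b i.i.d. draws from mu *)
Fixpoint sgd_expect dX (Xi : measurableType dX) (mu : probability Xi R)
    (b t : nat) (F : (nat -> seq Xi) -> \bar R) : \bar R :=
  match t with
  | 0 => F (fun _ => [::])
  | t'.+1 => iid_int mu b (fun xs =>
               sgd_expect mu b t' (fun ys => F (shift_draws xs ys)))
  end.

Definition B_T (eta : nat -> R) (T : nat) : R := (\sum_(t < T) eta t)^-1.
Definition V_T (eta : nat -> R) (b T : nat) : R :=
  (\sum_(t < T) eta t ^+ 2) / (b%:R * \sum_(t < T) eta t).

Definition eta_const (emax : R) : nat -> R := fun _ => emax.
Definition eta_dimin (emax : R) : nat -> R :=
  fun t => emax / Num.sqrt (t.+1%:R).
Definition K_epoch (n b : nat) : nat := `|Num.ceil (n%:R / b%:R : R)|%N.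
Definition eta_cos (emin emax : R) (K E : nat) : nat -> R :=
  fun t => emin + (emax - emin) / 2 *
    (1 + cos ((Num.floor (t%:R / K%:R : R))%:~R * (pi / E%:R))).
Definition eta_poly (emin emax p : R) (T : nat) : nat -> R :=
  fun t => (emax - emin) * (1 - t%:R / T%:R) `^ p + emin.

End Defs.

(* Main.v *)
Require Import Defs.
From HB Require Import structures.
From mathcomp Require Import all_boot all_order all_algebra.
From mathcomp Require Import all_classical all_reals all_analysis.
From mathcomp Require Import measurable_realfun ring lra.
Set Implicit Arguments. Unset Strict Implicit. Unset Printing Implicit Defensive.
Import Order.TTheory GRing.Theory Num.Theory.
Import numFieldNormedType.Exports.
Local Open Scope classical_set_scope.
Local Open Scope ring_scope.

(* For the averaged objective the descent lemma gives, conditionally on theta,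
   E f(theta') <= f(theta) - eta (1 - Lbar eta / 2) |grad f(theta)|^2
                  + Lbar sigma^2 eta^2 / (2 b),
   and telescoping in t bounds the eta_t-weighted sum of the E |grad f(theta_t)|^2.
   The telescoping goes by peeling off the first batch, so theta and the schedule
   are generalized. The iterated integrals occurring there are only ever bounded
   from above by integrals of quadratic functions of the draws; on nonnegative
   functions the integral is a supremum over simple functions, hence monotone,
   superadditive and positively homogeneous (as an inequality) without any
   measurability assumption, so measurability of theta |-> E |grad f(theta_t)|^2
   never has to be established. *)

(** * Integration of nonnegative functions without measurability *)

Section LowerIntegral.
Local Open Scope ereal_scope.
Context (R : realType) (dX : measure_display) (Xi : measurableType dX).
Variable mu : {measure set Xi -> \bar R}.

Import HBNNSimple.

Lemma ge0_le_integral_nonmeas (f g : Xi -> \bar R) :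
  (forall x, 0 <= f x) -> (forall x, f x <= g x) ->
  \int[mu]_x f x <= \int[mu]_x g x.
Proof.
move=> f0 fg; have g0 x : 0 <= g x by exact: le_trans (fg x).
rewrite !ge0_integralTE//; apply: ereal_sup_le => _ [h hf <-].
by exists h => // x; exact: le_trans (fg x).
Qed.

(** If [h] and [k] are simple functions below [f] and [g], then [h + k] is a simple function below
    the sum, and on simple functions the integral is additive ([key]); it remains to take the two
    suprema. *)
Lemma ge0_integralD_nonmeas (f g : Xi -> \bar R) :
  (forall x, 0 <= f x) -> (forall x, 0 <= g x) ->
  \int[mu]_x f x + \int[mu]_x g x <= \int[mu]_x (f x + g x).
Proof.
move=> f0 g0.
have fg0 x : 0 <= f x + g x by rewrite adde_ge0.
have key (h k : {nnsfun Xi >-> R}) : (forall x, (h x)%:E <= f x) ->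
    (forall x, (k x)%:E <= g x) ->
    sintegral mu h + sintegral mu k <= \int[mu]_x (f x + g x).
  move=> hf kg; rewrite -sintegralD ge0_integralTE//; apply: ereal_sup_ubound.
  exists (add_nnsfun h k) => // x /=.
  by rewrite EFinD leeD.
(* Outside this case everything dominated by the right-hand side is finite, so a term can be moved
   across the inequality and the suprema over [h] and [k] taken one at a time. *)
have [->|Ioo] := eqVneq (\int[mu]_x (f x + g x)) +oo; first exact: leey.
have fin x : 0 <= x -> x <= \int[mu]_x (f x + g x) -> x \is a fin_num.
  by move=> x0 xI; rewrite ge0_fin_numE// (le_lt_trans xI)// ltey.
have gI : \int[mu]_x g x <= \int[mu]_x (f x + g x).
  by apply: ge0_le_integral_nonmeas => // x; rewrite leeDr.
have gfin : \int[mu]_x g x \is a fin_num by apply: fin gI; exact: integral_ge0.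
rewrite -leeBrDr// [leLHS]ge0_integralTE//; apply: ge_ereal_sup => _ [h hf <-].
have h0 := sintegral_ge0 mu h.
have hI : sintegral mu h <= \int[mu]_x (f x + g x).
  have := key h nnsfun0 hf; rewrite sintegral0 adde0; apply => x.
  exact: g0.
rewrite leeBrDr// addeC -leeBrDr ?fin// [leLHS]ge0_integralTE//.
apply: ge_ereal_sup => _ [k kg <-].
by rewrite leeBrDr ?fin// addeC key.
Qed.

Lemma ge0_integralZl_nonmeas (c : R) (f : Xi -> \bar R) : (0 <= c)%R ->
  (forall x, 0 <= f x) ->
  c%:E * \int[mu]_x f x <= \int[mu]_x (c%:E * f x).
Proof.
move=> c0 f0.
have cf0 x : 0 <= c%:E * f x by rewrite mule_ge0.
have [->|cn0] := eqVneq c 0%R; first by rewrite mul0e integral_ge0// => x _; rewrite mul0e.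
have cp : (0 < c)%R by rewrite lt_neqAle eq_sym cn0.
rewrite -lee_pdivlMl// [leLHS]ge0_integralTE//.
apply: ge_ereal_sup => _ [h hf <-].
rewrite lee_pdivlMl// -sintegralrM ge0_integralTE//.
apply: ereal_sup_ubound; exists (scale_nnsfun h c0) => // x /=.
by rewrite EFinM lee_wpmul2l.
Qed.
End LowerIntegral.

(** * Iterated integrals over i.i.d. draws *)

Section IidIntegral.
Local Open Scope ereal_scope.
Context (R : realType) (dX : measure_display) (Xi : measurableType dX).
Variable mu : probability Xi R.
Implicit Types (h k : seq Xi -> \bar R) (n : nat).

Lemma iid_int_ge0 n h : (forall s, 0 <= h s) -> 0 <= iid_int mu n h.
Proof.
elim: n h => [|n IH] h h0 /=; first exact: h0.
by apply: integral_ge0 => x _; apply: IH.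
Qed.

Lemma le_iid_int n h k : (forall s, 0 <= h s) -> (forall s, size s = n -> h s <= k s) ->
  iid_int mu n h <= iid_int mu n k.
Proof.
elim: n h k => [|n IH] h k h0 hk /=; first exact: hk.
apply: ge0_le_integral_nonmeas => x; first exact: iid_int_ge0.
by apply: IH => // s sn; apply: hk; rewrite /= sn.
Qed.

(** Only lists of length [n] are ever evaluated. This is how the batch size enters: centring a batch
    sum removes exactly [b] copies of the mean gradient. *)
Lemma eq_iid_int n h k : (forall s, size s = n -> h s = k s) ->
  iid_int mu n h = iid_int mu n k.
Proof.
elim: n h k => [|n IH] h k hk /=; first exact: hk.
by apply: eq_integral => x _; apply: IH => s sn; apply: hk; rewrite /= sn.
Qed.

Lemma iid_intD n h k : (forall s, 0 <= h s) -> (forall s, 0 <= k s) ->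
  iid_int mu n h + iid_int mu n k <= iid_int mu n (fun s => h s + k s).
Proof.
elim: n h k => [|n IH] h k h0 k0 //=.
have i0 (f : seq Xi -> \bar R) x : (forall s, 0 <= f s) ->
    0 <= iid_int mu n (fun s => f (x :: s)) by move=> f0; exact: iid_int_ge0.
apply: le_trans (ge0_integralD_nonmeas mu (fun x => i0 h x h0)
  (fun x => i0 k x k0)) _.
apply: ge0_le_integral_nonmeas => x; last exact: IH.
by rewrite adde_ge0// iid_int_ge0.
Qed.

Lemma iid_intZ n (c : R) h : (0 <= c)%R -> (forall s, 0 <= h s) ->
  c%:E * iid_int mu n h <= iid_int mu n (fun s => c%:E * h s).
Proof.
move=> c0; elim: n h => [|n IH] h h0 //=.
have i0 x : 0 <= iid_int mu n (fun s => h (x :: s)) by exact: iid_int_ge0.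
apply: le_trans (ge0_integralZl_nonmeas mu c0 i0) _.
apply: ge0_le_integral_nonmeas => x; last exact: IH.
by rewrite mule_ge0// iid_int_ge0.
Qed.

(** Moves the weighted sum over later steps inside the integral over the first batch, where an
    induction hypothesis can be applied for each fixed batch. *)
Lemma iid_int_sum n (I : Type) (r : seq I) (c : I -> R) (h : I -> seq Xi -> \bar R) :
  (forall i, (0 <= c i)%R) -> (forall i s, 0 <= h i s) ->
  \sum_(i <- r) (c i)%:E * iid_int mu n (h i)
    <= iid_int mu n (fun s => \sum_(i <- r) (c i)%:E * h i s).
Proof.
move=> c0 h0; elim: r => [|i r IH].
  by rewrite big_nil iid_int_ge0// => s; rewrite big_nil.
have ch0 j s : 0 <= (c j)%:E * h j s by rewrite mule_ge0 ?lee_fin ?c0 ?h0.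
rewrite big_cons.
have -> : (fun s => \sum_(j <- i :: r) (c j)%:E * h j s) =
    (fun s => (c i)%:E * h i s + \sum_(j <- r) (c j)%:E * h j s).
  by apply/funext => s; rewrite big_cons.
apply: (@le_trans _ _ (iid_int mu n (fun s => (c i)%:E * h i s) +
    iid_int mu n (fun s => \sum_(j <- r) (c j)%:E * h j s))).
  by rewrite leeD// iid_intZ.
by apply: iid_intD => // s; apply: sume_ge0 => j _; exact: ch0.
Qed.

Lemma sgd_expect_ge0 b t (F : (nat -> seq Xi) -> \bar R) :
  (forall xi, 0 <= F xi) -> 0 <= sgd_expect mu b t F.
Proof.
elim: t F => [|t IH] F F0 /=; first exact: F0.
by apply: iid_int_ge0 => xs; apply: IH.
Qed.

End IidIntegral.

(** After its first batch, SGD is again SGD, started at the first iterate with the schedule shifted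
    by one; this is the peeling step of the telescoping induction. *)
Lemma sgd_iter_shift (R : realType) (Xi : Type) d (G : Xi -> 'rV[R]_d -> 'rV[R]_d)
    (eta : nat -> R) (b : nat) (theta : 'rV[R]_d) xs ys t :
  sgd_iter G eta b theta (shift_draws xs ys) t.+1 =
  sgd_iter G (fun s => eta s.+1) b
    (theta - (eta 0%N * b%:R^-1) *: \sum_(x <- xs) G x theta) ys t.
Proof. by elim: t => // t /= ->. Qed.

(** * Batch moments and smooth functions *)

Section Euclidean.
Context (R : realType) (d : nat).
Implicit Types (u v w : 'rV[R]_d) (c : R).

Lemma dotvC u v : dotv u v = dotv v u.
Proof. by apply: eq_bigr => j _; rewrite mulrC. Qed.

Lemma dotvDl u v w : dotv (u + v) w = dotv u w + dotv v w.
Proof. by rewrite -big_split; apply: eq_bigr => j _; rewrite mxE mulrDl. Qed.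

Lemma dotvZl c u w : dotv (c *: u) w = c * dotv u w.
Proof. by rewrite mulr_sumr; apply: eq_bigr => j _; rewrite mxE mulrA. Qed.

Lemma dotvBl u v w : dotv (u - v) w = dotv u w - dotv v w.
Proof. by rewrite dotvDl -scaleN1r dotvZl mulN1r. Qed.

Lemma dotvDr u v w : dotv w (u + v) = dotv w u + dotv w v.
Proof. by rewrite !(dotvC w) dotvDl. Qed.

Lemma dotvZr c u w : dotv w (c *: u) = c * dotv w u.
Proof. by rewrite !(dotvC w) dotvZl. Qed.

Lemma dotv0 u : dotv u 0 = 0.
Proof. by rewrite -(scale0r 0) dotvZr mul0r. Qed.

Lemma sqnormE u : sqnorm u = dotv u u.
Proof. by apply: eq_bigr => j _; rewrite expr2. Qed.

Lemma sqnorm_ge0 u : 0 <= sqnorm u.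
Proof. by apply: sumr_ge0 => j _; exact: sqr_ge0. Qed.

Lemma sqnormD u v : sqnorm (u + v) = sqnorm u + 2 * dotv u v + sqnorm v.
Proof. by rewrite !sqnormE dotvDl !dotvDr (dotvC v u); ring. Qed.

Lemma sqnormZ c u : sqnorm (c *: u) = c ^+ 2 * sqnorm u.
Proof. by rewrite !sqnormE dotvZl dotvZr expr2 mulrA. Qed.

Lemma sqr_enorm u : enorm u ^+ 2 = sqnorm u.
Proof. by rewrite sqr_sqrtr// sqnorm_ge0. Qed.

Lemma enormZ c u : enorm (c *: u) = `|c| * enorm u.
Proof. by rewrite /enorm sqnormZ sqrtrM ?sqr_ge0// sqrtr_sqr. Qed.

Lemma enorm_ge0 u : 0 <= enorm u.
Proof. exact: sqrtr_ge0. Qed.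

Lemma enorm_eq0 u : enorm u = 0 -> u = 0.
Proof.
move=> u0; have /eqP : sqnorm u = 0 by rewrite -sqr_enorm u0 expr0n.
rewrite psumr_eq0 => [/allP uj0|j _]; last exact: sqr_ge0.
apply/rowP => j; apply/eqP; rewrite mxE -sqrf_eq0.
exact: uj0 (mem_index_enum j).
Qed.

(** Cauchy-Schwarz: for nonzero [u] and [v], the squared norm of [enorm v *: u - enorm u *: v] is
    [2 * (enorm u * enorm v)] times the difference of the two sides. *)
Lemma dotv_le_enorm u v : dotv u v <= enorm u * enorm v.
Proof.
have [/enorm_eq0 ->|un0] := eqVneq (enorm u) 0.
  by rewrite dotvC dotv0 mulr_ge0// sqrtr_ge0.
have [/enorm_eq0 ->|vn0] := eqVneq (enorm v) 0.
  by rewrite dotv0 mulr_ge0// sqrtr_ge0.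
have u0 : 0 < enorm u by rewrite lt_neqAle eq_sym un0 sqrtr_ge0.
have v0 : 0 < enorm v by rewrite lt_neqAle eq_sym vn0 sqrtr_ge0.
have := sqnorm_ge0 (enorm v *: u + (- enorm u) *: v).
rewrite sqnormD !sqnormZ -!sqr_enorm dotvZl dotvZr.
have -> : enorm v ^+ 2 * enorm u ^+ 2 + 2 * (enorm v * (- enorm u * dotv u v)) +
    (- enorm u) ^+ 2 * enorm v ^+ 2 =
    2 * (enorm u * enorm v) * (enorm u * enorm v - dotv u v) by ring.
by rewrite pmulr_rge0 ?mulr_gt0// subr_ge0.
Qed.

End Euclidean.

Section BatchMoments.
Context (R : realType) (dX : measure_display) (Xi : measurableType dX).
Variables (mu : probability Xi R) (d : nat) (D : Xi -> 'rV[R]_d) (tau : R).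
Hypothesis Dint : forall j, mu.-integrable setT (fun x => (D x ord0 j)%:E).
Hypothesis Dmean : forall j, (\int[mu]_x (D x ord0 j)%:E = 0)%E.
Hypothesis Dvar : (\int[mu]_x (sqnorm (D x))%:E = tau%:E)%E.

Lemma integrable_sqnorm : mu.-integrable setT (fun x => (sqnorm (D x))%:E).
Proof.
apply/integrableP; split.
  apply/measurable_EFinP; apply: measurable_sum => j.
  by apply: measurable_funX; apply/measurable_EFinP; exact: measurable_int (Dint j).
under eq_integral do rewrite gee0_abs ?lee_fin ?sqnorm_ge0//.
by rewrite Dvar ltry.
Qed.

Lemma integral_quadratic (a c : R) (v : 'rV[R]_d) :
  (\int[mu]_x (a + dotv v (D x) + c * sqnorm (D x))%:E = (a + c * tau)%:E)%E.
Proof.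
have dotE x : (dotv v (D x))%:E = (\sum_(j < d) (v ord0 j)%:E * (D x ord0 j)%:E)%E.
  by rewrite -sumEFin.
have vDint j : mu.-integrable setT (fun x => (v ord0 j)%:E * (D x ord0 j)%:E)%E.
  exact: integrableZl.
have dint : mu.-integrable setT (fun x => (dotv v (D x))%:E).
  under eq_fun do rewrite dotE; exact: integrable_sum.
have d0 : (\int[mu]_x (dotv v (D x))%:E = 0)%E.
  under eq_integral do rewrite dotE.
  rewrite integral_sum// big1// => j _.
  by rewrite integralZl// Dmean mule0.
have aint : mu.-integrable setT (fun x : Xi => a%:E).
  exact: finite_measure_integrable_cst.
have cint : mu.-integrable setT (fun x => c%:E * (sqnorm (D x))%:E)%E.
  by apply: integrableZl => //; exact: integrable_sqnorm.
under eq_integral do rewrite EFinD EFinM EFinD.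
rewrite integralD//; last exact: integrableD.
have a0 : (\int[mu]_x a%:E = a%:E)%E.
  by rewrite -[RHS](expectation_cst mu) unlock.
rewrite integralD// d0 adde0 a0.
by rewrite integralZl ?Dvar//; exact: integrable_sqnorm.
Qed.

(** The variance of a sum of independent centred draws is the sum of the variances. Fixing the first
    draw [x] leaves a quadratic in the remaining sum: the cross term turns [v] into
    [v + (2 * c) *: D x], and the rest goes into [a]; hence the induction generalizes [a] and
    [v]. *)
Lemma iid_int_quadratic n (a c : R) (v : 'rV[R]_d) :
  iid_int mu n (fun s => (a + dotv v (\sum_(x <- s) D x)
    + c * sqnorm (\sum_(x <- s) D x))%:E) = (a + c * (n%:R * tau))%:E.
Proof.
elim: n a v => [|n IH] a v /=.
  by rewrite big_nil dotv0 sqnormE dotv0 mul0r !mulr0 !addr0.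
transitivity (\int[mu]_x
    ((a + c * (n%:R * tau)) + dotv v (D x) + c * sqnorm (D x))%:E)%E; last first.
  by rewrite integral_quadratic; congr EFin; rewrite -natr1; ring.
apply: eq_integral => x _.
rewrite (_ : _ + _ + _ = (a + dotv v (D x) + c * sqnorm (D x)) + c * (n%:R * tau)); last by ring.
rewrite -(IH _ (v + (2 * c) *: D x)); congr iid_int; apply/funext => s.
rewrite big_cons dotvDr sqnormD dotvDl dotvZl; congr EFin; ring.
Qed.

End BatchMoments.

Section Descent.
Context (R : realType) (d : nat).

(** Along the segment from [x] to [x + v], [phi] is [f] minus its quadratic upper model, up to a
    constant. By Cauchy-Schwarz and the Lipschitz bound its derivative is nonpositive for [s >= 0],
    so the mean value theorem gives [phi 1 <= phi 0]. *)
Lemma descent (f : 'rV[R]_d -> R) (g : 'rV[R]_d -> 'rV[R]_d) (L : R) (x v : 'rV[R]_d) :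
  (forall x, differentiable f x /\ forall v, 'd f x v = dotv (g x) v) ->
  (forall x y, enorm (g x - g y) <= L * enorm (x - y)) ->
  f (x + v) <= f x + dotv (g x) v + L / 2 * sqnorm v.
Proof.
move=> fd gL.
pose phi (s : R) := f (x + s *: v) - s * dotv (g x) v - s ^+ 2 * (L / 2 * sqnorm v).
pose dphi (s : R) := dotv (g (x + s *: v)) v - dotv (g x) v - s * (L * sqnorm v).
have dp (s : R) : is_derive s 1 phi (dphi s).
  have dF : is_derive s 1 (fun r => f (x + r *: v)) (dotv (g (x + s *: v)) v).
    (* The difference quotient of the restriction to the line is that of [f] in direction [v], so
       the derivative in [s] is a directional derivative of [f]. *)
    have quotE : (fun h : R => h^-1 *: (((fun r => f (x + r *: v)) \o shift s) (h *: 1)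
        - f (x + s *: v))) =
      (fun h => h^-1 *: ((f \o shift (x + s *: v)) (h *: v) - f (x + s *: v))).
      apply/funext => h /=; rewrite scalerDl addrCA.
      by rewrite [h *: 1]mulr1.
    have [fdx fgx] := fd (x + s *: v).
    have fdv : derivable f (x + s *: v) v by exact: diff_derivable.
    split; first by rewrite /derivable quotE.
    by rewrite /derive quotE -fgx -deriveE.
  rewrite /phi /dphi; apply: is_derive_eq.
  by rewrite /GRing.scale /=; field.
have dphi0 s : 0 <= s -> dphi s <= 0.
  move=> s0; rewrite /dphi.
  have := dotv_le_enorm (g (x + s *: v) - g x) v.
  have := gL (x + s *: v) x.
  rewrite addrAC subrr add0r enormZ ger0_norm// => h1 h2.
  have := le_trans h2 (ler_wpM2r (enorm_ge0 v) h1).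
  rewrite dotvBl -sqr_enorm (_ : L * (s * enorm v) * enorm v = s * (L * enorm v ^+ 2)); last by ring.
  by rewrite subr_le0.
suff : phi 1 <= phi 0.
  rewrite /phi scale1r scale0r addr0; lra.
have phic : {within `[0, 1], continuous phi}.
  apply: continuous_subspaceT => s.
  by apply: differentiable_continuous; apply/derivable1_diffP; exact: ex_derive.
have [s] := MVT_segment ler01 (fun s _ => dp s) phic.
rewrite in_itv/= => /andP[s0 _]; rewrite subr0 mulr1 => e.
by have := dphi0 s s0; rewrite -e; lra.
Qed.
End Descent.

(** * Main bound *)

Section MainBound.
Context (R : realType) (n d : nat).
Variables (fs : 'I_n -> 'rV[R]_d -> R) (gs : 'I_n -> 'rV[R]_d -> 'rV[R]_d).
Variables (L : 'I_n -> R).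
Context (dX : measure_display) (Xi : measurableType dX).
Variables (mu : probability Xi R) (G : Xi -> 'rV[R]_d -> 'rV[R]_d) (sigma : R).
Variable b : nat.
Hypothesis n0 : (0 < n)%N.
Hypothesis fsd : forall i x, differentiable (fs i) x /\
  forall v, 'd (fs i) x v = dotv (gs i x) v.
Hypothesis L0 : forall i, 0 < L i.
Hypothesis gsL : forall i x y, enorm (gs i x - gs i y) <= L i * enorm (x - y).
Hypothesis fs_lb : forall i, has_lbound (range (fs i)).
Hypothesis Gint : forall x (j : 'I_d),
  mu.-integrable [set: Xi] (fun xi => (G xi x ord0 j)%:E).
Hypothesis Gmean : forall x (j : 'I_d),
  (\int[mu]_xi (G xi x ord0 j)%:E)%E = (avg_grad gs x ord0 j)%:E.
Hypothesis Gvar : forall x,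
  (\int[mu]_xi (sqnorm (G xi x - avg_grad gs x))%:E <= (sigma ^+ 2)%:E)%E.
Hypothesis b0 : (0 < b)%N.

Let f := avg_fun fs.
Let g := avg_grad gs.
Let Lbar := avg_const L.
Let fmin := avg_const (fun i => fstar (fs i)).

Lemma avg_const_gt0 : 0 < Lbar.
Proof.
rewrite mulr_gt0 ?invr_gt0 ?ltr0n// (bigD1 (Ordinal n0))//=.
by rewrite ltr_pwDl// sumr_ge0// => i _; exact: ltW.
Qed.

Lemma avg_fun_lb x : fmin <= f x.
Proof.
rewrite ler_wpM2l ?invr_ge0// ler_sum// => i _.
by apply: ge_inf => //; exists x.
Qed.

(** Averaging the descent inequalities of the [fs i], each with its own constant [L i], produces
    exactly the averaged constant [Lbar]. *)
Lemma avg_descent x v : f (x + v) <= f x + dotv (g x) v + Lbar / 2 * sqnorm v.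
Proof.
rewrite /f /g /Lbar /avg_fun /avg_grad /avg_const dotvZl.
have -> : dotv (\sum_(i < n) gs i x) v = \sum_(i < n) dotv (gs i x) v.
  by apply: (big_morph (fun u => dotv u v)) => [u w|]; rewrite ?dotvDl// dotvC dotv0.
rewrite -!mulrA -!mulrDr ler_wpM2l ?invr_ge0// mulr_suml -!big_split /=.
apply: ler_sum => i _; rewrite mulrA; exact: descent.
Qed.

(** Writing the batch sum as [b] copies of the gradient plus a centred sum makes the integrand
    quadratic in the latter, whose mean is 0 and whose variance is [b] times that of one draw. The
    free constant [c] later carries the noise terms of the remaining steps and [- fmin]. *)
Lemma expected_descent theta (eta : R) : 0 <= eta ->
  forall c : R, (iid_int mu b (fun xs => (f theta
     + dotv (g theta) (- ((eta * b%:R^-1) *: \sum_(x <- xs) G x theta))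
     + Lbar / 2 * sqnorm (- ((eta * b%:R^-1) *: \sum_(x <- xs) G x theta)) + c)%:E)
  <= (f theta - eta * (1 - Lbar * eta / 2) * sqnorm (g theta)
       + Lbar * sigma ^+ 2 / (2 * b%:R) * eta ^+ 2 + c)%:E)%E.
Proof.
move=> eta0 c.
have bR : (0 : R) < b%:R by rewrite ltr0n.
pose D x := G x theta - g theta.
have cst_int j : mu.-integrable setT (fun _ : Xi => (g theta ord0 j)%:E).
  exact: finite_measure_integrable_cst.
have DE j x : (D x ord0 j)%:E = ((G x theta ord0 j)%:E - (g theta ord0 j)%:E)%E.
  by rewrite !mxE.
have Dint j : mu.-integrable setT (fun x => (D x ord0 j)%:E).
  by under eq_fun do rewrite DE; exact: integrableB.
have Dmean j : (\int[mu]_x (D x ord0 j)%:E = 0)%E.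
  under eq_integral do rewrite DE.
  rewrite integralB// Gmean.
  have -> : (\int[mu]_x (g theta ord0 j)%:E = (g theta ord0 j)%:E)%E.
    by rewrite -[RHS](expectation_cst mu) unlock.
  by rewrite subee.
(* The variance lies between 0 and [sigma ^+ 2], so it is a real number [tau], and the exact moment
   formula applies to it. *)
have [tau Dvar tau_le] : exists2 tau : R,
    (\int[mu]_x (sqnorm (D x))%:E = tau%:E)%E & tau <= sigma ^+ 2.
  have := Gvar theta; rewrite -/(D _).
  have : (0 <= \int[mu]_x (sqnorm (D x))%:E)%E.
    by apply: integral_ge0 => x _; rewrite lee_fin sqnorm_ge0.
  rewrite /D; case: (integral _ _ _) => [r|//|//] _ h; by exists r.
(* [A], [w] and [C] are the constant, linear and quadratic coefficients of the integrand in the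
   centred batch sum. *)
pose A := f theta - eta * (1 - Lbar * eta / 2) * sqnorm (g theta) + c.
pose w := (eta / b%:R * (Lbar * eta - 1)) *: g theta.
pose C := Lbar / 2 * (eta / b%:R) ^+ 2.
rewrite (@eq_iid_int _ _ _ _ _ _ (fun s => (A + dotv w (\sum_(x <- s) D x)
    + C * sqnorm (\sum_(x <- s) D x))%:E)); last first.
  move=> s sb; congr EFin.
  have -> : \sum_(x <- s) G x theta = \sum_(x <- s) D x + b%:R *: g theta.
    rewrite big_split /= -addrA -sb.
    rewrite big_const_seq count_predT iter_addr_0 mulNrn scaler_nat addNr.
    by rewrite addr0.
  move: (\sum_(x <- s) D x) => S; rewrite /A /w /C -scaleNr.
  rewrite dotvZr dotvDr dotvZr sqnormZ sqnormD sqnormZ dotvZr dotvZl.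
  rewrite (dotvC S) -sqnormE.
  by field; rewrite gt_eqF.
rewrite (iid_int_quadratic Dint Dmean Dvar) lee_fin /A /C.
have -> : Lbar / 2 * (eta / b%:R) ^+ 2 * (b%:R * tau) = Lbar / (2 * b%:R) * eta ^+ 2 * tau.
  by field; rewrite gt_eqF.
have -> : Lbar * sigma ^+ 2 / (2 * b%:R) * eta ^+ 2 = Lbar / (2 * b%:R) * eta ^+ 2 * sigma ^+ 2.
  by field; rewrite gt_eqF.
rewrite [leRHS]addrAC lerD2l ler_wpM2l// mulr_ge0 ?sqr_ge0//.
by rewrite divr_ge0 ?ltW ?avg_const_gt0// mulr_gt0.
Qed.

Lemma weighted_sum_bound T (eta : nat -> R) theta :
  (forall t, 0 <= eta t) -> (forall t, Lbar * eta t <= 2) ->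
  (\sum_(t < T) (eta t * (1 - Lbar * eta t / 2))%:E *
     sgd_expect mu b t (fun xi => (sqnorm (g (sgd_iter G eta b theta xi t)))%:E)
   <= (f theta - fmin + Lbar * sigma ^+ 2 / (2 * b%:R) * \sum_(t < T) eta t ^+ 2)%:E)%E.
Proof.
elim: T eta theta => [|T IH] eta theta eta0 eta2.
  (* With no step left, the claim is that [f] is bounded below by the average of the infima. *)
  by rewrite !big_ord0 mulr0 addr0 lee_fin subr_ge0 avg_fun_lb.
have bR : (0 : R) < b%:R by rewrite ltr0n.
have co0 t : 0 <= eta t * (1 - Lbar * eta t / 2).
  by rewrite mulr_ge0// subr_ge0; have := eta2 t; lra.
pose step xs := theta - (eta 0%N * b%:R^-1) *: \sum_(x <- xs) G x theta.
(* The expected squared gradient norm [t] steps after the first one, conditionally on the first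
   batch [xs]. *)
pose h (t : nat) xs := sgd_expect mu b t (fun ys =>
  (sqnorm (g (sgd_iter G (fun s => eta s.+1) b (step xs) ys t)))%:E).
have h0 t xs : (0 <= h t xs)%E.
  by apply: sgd_expect_ge0 => ys; rewrite lee_fin sqnorm_ge0.
have hE (t : nat) : sgd_expect mu b t.+1 (fun xi =>
    (sqnorm (g (sgd_iter G eta b theta xi t.+1)))%:E) = iid_int mu b (h t).
  rewrite [LHS]/=; congr iid_int; apply/funext => xs.
  congr sgd_expect; apply/funext => ys.
  by rewrite -[X in g X]/(sgd_iter G eta b theta (shift_draws xs ys) t.+1) sgd_iter_shift.
rewrite !big_ord_recl; under eq_bigr => t _ do rewrite [nat_of_ord (lift _ _)]/= hE.
set K := Lbar * sigma ^+ 2 / (2 * b%:R).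
have K0 : 0 <= K.
  by rewrite divr_ge0// mulr_ge0 ?sqr_ge0// ltW// avg_const_gt0.
set c := K * \sum_(t < T) eta t.+1 ^+ 2.
have c0 : 0 <= c by rewrite mulr_ge0// sumr_ge0// => t _; exact: sqr_ge0.
(* For each first batch the induction hypothesis bounds the tail by the value of [f] at the new
   iterate plus [c - fmin]; [avg_descent] replaces that value by a quadratic in the draws, which
   [expected_descent] integrates. *)
have tail_le : (\sum_(t < T) (eta t.+1 * (1 - Lbar * eta t.+1 / 2))%:E * iid_int mu b (h t)
    <= (f theta - eta 0%N * (1 - Lbar * eta 0%N / 2) * sqnorm (g theta)
       + K * eta 0%N ^+ 2 + (c - fmin))%:E)%E.
  apply: le_trans (expected_descent theta (eta0 0%N) (c - fmin)).
  apply: (@le_trans _ _ (iid_int mu b (fun xs =>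
      \sum_(t < T) (eta t.+1 * (1 - Lbar * eta t.+1 / 2))%:E * h t xs)%E)).
    exact: iid_int_sum.
  apply: le_iid_int => [xs|xs _].
    by apply: sume_ge0 => t _; rewrite mule_ge0 ?lee_fin ?co0 ?h0.
  apply: le_trans (IH (fun s => eta s.+1) (step xs) _ _) _ => //.
  rewrite -/K -/c lee_fin.
  have := avg_descent theta (- ((eta 0%N * b%:R^-1) *: \sum_(x <- xs) G x theta)).
  by rewrite -/(step xs); lra.
apply: le_trans (leeD (lexx _) tail_le) _.
rewrite [sgd_expect _ _ _ _]/= -EFinM -EFinD lee_fin /c mulrDr.
by rewrite [nat_of_ord ord0]/=; lra.
Qed.
(** In [weighted_sum_bound] each expectation is at least the minimum [m] and each weight at least
    [eta t * (1 - Lbar * eta_max / 2)]; then divide by the sum of these. A nonzero sum of rates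
    excludes [T = 0], where the minimum would be its default [+oo]. *)
Lemma min_sqnorm_bound (eta : nat -> R) (eta_min eta_max : R) theta T :
  (forall t, eta_min <= eta t <= eta_max) ->
  0 <= eta_min -> eta_max < 2 / Lbar -> \sum_(t < T) eta t != 0 ->
  (\big[mine/+oo%E]_(t < T)
      sgd_expect mu b t (fun xi => (sqnorm (g (sgd_iter G eta b theta xi t)))%:E)
    <= ((2 * (f theta - fmin)) / (2 - Lbar * eta_max) * B_T eta T
        + Lbar * sigma ^+ 2 / (2 - Lbar * eta_max) * V_T eta b T)%:E)%E.
Proof.
move=> eta_bd emin0 emaxL S0.
have Lb := avg_const_gt0.
have bR : (0 : R) < b%:R by rewrite ltr0n.
have eta0 t : 0 <= eta t by case/andP: (eta_bd t) => + _; exact: le_trans.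
have etaM t : eta t <= eta_max by case/andP: (eta_bd t).
have LM : 0 < 2 - Lbar * eta_max by rewrite subr_gt0 mulrC -ltr_pdivlMr.
have Sp : 0 < \sum_(t < T) eta t by rewrite lt_neqAle eq_sym S0 sumr_ge0.
have LetaM t : Lbar * eta t <= Lbar * eta_max by rewrite ler_pM2l.
have eta2 t : Lbar * eta t <= 2 by have := LetaM t; lra.
have := @weighted_sum_bound T eta theta eta0 eta2.
pose E (t : nat) := sgd_expect mu b t
  (fun xi => (sqnorm (g (sgd_iter G eta b theta xi t)))%:E).
set m := \big[mine/+oo%E]_(t < T) _.
have m0 : (0 <= m)%E.
  rewrite /m; elim/big_ind: _ => [|x y x0 y0|t _]; first exact: leey.
    by rewrite le_min x0.
  by apply: sgd_expect_ge0 => xi; rewrite lee_fin sqnorm_ge0.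
have mE (t : 'I_T) : (m <= E t)%E by exact: bigmin_le_cond.
move=> bd.
have {bd} : ((\sum_(t < T) eta t * (1 - Lbar * eta_max / 2))%:E * m <=
   (f theta - fmin + Lbar * sigma ^+ 2 / (2 * b%:R) * \sum_(t < T) eta t ^+ 2)%:E)%E.
  apply: le_trans bd; rewrite -sumEFin ge0_sume_distrl => [|t _]; last first.
    by rewrite lee_fin mulr_ge0//; lra.
  apply: lee_sum => t _; apply: lee_pmul => //; last exact: mE.
    by rewrite lee_fin mulr_ge0//; lra.
  rewrite lee_fin ler_wpM2l//; have := LetaM t; lra.
rewrite -mulr_suml muleC -lee_pdivlMr; last by rewrite mulr_gt0//; lra.
(* The quotient obtained is equal to the claimed bound, so only a field identity remains. *)
move=> /le_trans; apply; rewrite -EFinM lee_fin /B_T /V_T le_eqVlt; apply/orP; left.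
apply/eqP; field.
by rewrite !gt_eqF//; lra.
Qed.
End MainBound.

(** * Learning rate schedules *)

Lemma const_schedule (R : realType) (eta_max : R) (b T : nat) :
   0 <= eta_max -> (0 < b)%N -> (0 < T)%N ->
   B_T (eta_const eta_max) T <= (eta_max * T%:R)^-1 /\
   V_T (eta_const eta_max) b T <= eta_max / b%:R.
Proof.
move=> e0 b0 T0; rewrite /B_T /V_T /eta_const !sumr_const card_ord.
rewrite -(mulr_natr eta_max) -(mulr_natr (eta_max ^+ 2)); split=> //.
have bR : (0 : R) < b%:R by rewrite ltr0n.
have TR : (0 : R) < T%:R by rewrite ltr0n.
have [->|en0] := eqVneq eta_max 0; first by rewrite expr2 !mul0r.
rewrite [leLHS](_ : _ = eta_max / b%:R)//.
by field; rewrite en0 !gt_eqF.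
Qed.

(* [1/sqrt k = 2/(2 sqrt k)] lies above [2/(sqrt(k+1) + sqrt k) = 2(sqrt(k+1) - sqrt k)] *)
Lemma sum_invsqrt_ge (R : realType) (T : nat) :
  2 * (Num.sqrt (T.+1%:R) - 1) <= \sum_(t < T) (Num.sqrt (t.+1%:R : R))^-1.
Proof.
elim: T => [|T IH]; first by rewrite big_ord0 sqrtr1 subrr mulr0.
rewrite big_ord_recr /=.
set s := Num.sqrt T.+1%:R in IH *; set s' := Num.sqrt T.+2%:R.
have s0 : (0 : R) < s by rewrite sqrtr_gt0 ltr0n.
have ss : s ^+ 2 = T.+1%:R by rewrite sqr_sqrtr.
have ss' : s' ^+ 2 = s ^+ 2 + 1 by rewrite ss sqr_sqrtr// natr1.
suff : 2 * (s' - s) <= s^-1 by lra.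
rewrite -[leRHS]mul1r ler_pdivlMr//.
have := sqr_ge0 (s' - s); rewrite sqrrB ss'; lra.
Qed.

(** With [k = T.+2], the increment [ln k - ln (k - 1)] is [- ln (1 - k^-1)], which is at least
    [k^-1] because [ln (1 + x) <= x]. *)
Lemma harmonic_le_ln (R : realType) (T : nat) : (0 < T)%N ->
  \sum_(t < T) (t.+1%:R : R)^-1 <= 1 + ln T%:R.
Proof.
elim: T => // -[_ _|T IH _]; first by rewrite big_ord1 ln1 addr0 invr1.
rewrite big_ord_recr /=.
rewrite (_ : 1 + ln T.+2%:R = 1 + ln T.+1%:R + (ln T.+2%:R - ln T.+1%:R)); last by ring.
apply: lerD; first exact: IH.
have T2 : (0 : R) < T.+2%:R by rewrite ltr0n.
have T1 : (0 : R) < T.+1%:R by rewrite ltr0n.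
have e : T.+1%:R = (1 + - (T.+2%:R)^-1) * T.+2%:R :> R.
  by rewrite mulrDl mulNr mulVf ?gt_eqF// mul1r -[in RHS]natr1 addrK.
have p : (0 : R) < 1 - T.+2%:R^-1.
  by rewrite subr_gt0 invf_lt1// ltr1n.
rewrite [X in _ - ln X]e lnM ?posrE//.
have : ln (1 - T.+2%:R^-1) <= - (T.+2%:R^-1 : R).
  by apply: le_ln1Dx; rewrite -subr_gt0 opprK addrC.
by move: (ln (1 - _)) => l h; rewrite opprD addrCA subrr addr0 lerNr.
Qed.

Lemma dimin_schedule (R : realType) (eta_max : R) (b T : nat) :
   0 <= eta_max -> (0 < b)%N -> (0 < T)%N ->
   B_T (eta_dimin eta_max) T
     <= (2 * eta_max * (Num.sqrt (T.+1%:R) - 1))^-1 /\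
   V_T (eta_dimin eta_max) b T
     <= eta_max * (1 + ln T%:R) / (2 * b%:R * (Num.sqrt (T.+1%:R) - 1)).
Proof.
move=> e0 b0 T0; rewrite /B_T /V_T /eta_dimin -mulr_sumr.
have -> : \sum_(t < T) (eta_max / Num.sqrt (t.+1%:R)) ^+ 2 =
          eta_max ^+ 2 * \sum_(t < T) (t.+1%:R : R)^-1.
  rewrite mulr_sumr; apply: eq_bigr => t _.
  by rewrite exprMn exprVn sqr_sqrtr.
have := sum_invsqrt_ge R T; have := @harmonic_le_ln R T T0.
set H := (X in X <= 1 + _); set S := (X in 2 * _ <= X).
set r := _ - 1; set l := 1 + _ => Hl rS.
have r0 : 0 < r.
  rewrite subr_gt0 -[ltLHS]sqrtr1 ltr_sqrt ?ltr0n//.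
  by rewrite ltr1n ltnS.
have bR : (0 : R) < b%:R by rewrite ltr0n.
have H0 : 0 <= H by apply: sumr_ge0 => t _; rewrite invr_ge0.
have S0 : 0 < S by rewrite (lt_le_trans _ rS)// mulr_gt0.
(* For [eta_max = 0] all four sides are 0, by the convention that the inverse of 0 is 0. *)
move: e0; rewrite le_eqVlt => /predU1P[<-|e0].
  by rewrite expr2 !(mul0r, mulr0) invr0.
split.
  rewrite lef_pV2 ?posrE ?mulr_gt0// -mulrA mulrCA.
  by rewrite ler_wpM2l// ltW.
have -> : eta_max ^+ 2 * H / (b%:R * (eta_max * S)) = (eta_max / b%:R) * (H / S).
  by field; rewrite !gt_eqF.
have -> : eta_max * l / (2 * b%:R * r) = (eta_max / b%:R) * (l / (2 * r)).
  by field; rewrite !gt_eqF.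
apply: ler_wpM2l; first by rewrite divr_ge0// ltW.
apply: ler_pM => //; first by rewrite invr_ge0 ltW.
by rewrite lef_pV2// posrE mulr_gt0.
Qed.

(** * Trigonometric sums and the cosine schedule *)

Section Trig.
Context (R : realType).
Implicit Types E : nat.

(* The reflection [e -> E - e] negates [cos (e pi / E)], so the terms [e <= E]
   cancel and the sum over [e < E] is minus the last one *)
Lemma sum_cos_epochs E : (0 < E)%N ->
  \sum_(e < E) cos (e%:R * (pi / E%:R)) = 1 :> R.
Proof.
move=> E0; have ER : (E%:R : R) != 0 by rewrite pnatr_eq0 -lt0n.
have last : cos (E%:R * (pi / E%:R)) = -1 :> R by rewrite mulrCA divff// mulr1 cospi.
have refl : \sum_(e < E.+1) cos (e%:R * (pi / E%:R)) =
    - \sum_(e < E.+1) cos (e%:R * (pi / E%:R)) :> R.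
  rewrite {1}(reindex_inj rev_ord_inj) -sumrN /=; apply: eq_bigr => e _.
  rewrite subSS natrB -1?ltnS// mulrBl [E%:R * _]mulrCA divff// mulr1.
  by rewrite cosB cospi sinpi mul0r addr0 mulN1r.
move: refl; rewrite big_ord_recr /= last; lra.
Qed.

(** Halve the angle: [cos x ^+ 2 = (1 + cos (2 * x)) / 2]. Multiplied by [2 * sin th], the doubled
    cosines telescope to a difference of sines over a full period, so for [E >= 2] they sum to 0 and
    the total is [E / 2]. For [E = 1] the sine vanishes and the total is 1, which is why the bound
    has [E + 1]. *)
Lemma sum_cos2_epochs E : (0 < E)%N ->
  \sum_(e < E) cos (e%:R * (pi / E%:R)) ^+ 2 <= (E%:R + 1) / 2 :> R.
Proof.
case: E => [//|[_|E _]]; first by rewrite big_ord1 mul0r cos0 expr1n; lra.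
set th := pi / _.
have th0 : 0 < th < pi.
  by rewrite divr_gt0 ?pi_gt0//= ltr_pdivrMr// ltr_pMr ?pi_gt0// ltr1n.
have sin0 : 0 < sin th by exact: sin_gt0_pi.
have tele : \sum_(e < E.+2) 2 * sin th * cos (2 * (e%:R * th)) = 0.
  rewrite (eq_bigr (fun e : 'I_E.+2 => sin (2 * e.+1%:R * th - th) - sin (2 * e%:R * th - th))); last first.
    move=> e _; rewrite -[e.+1%:R]natr1 (_ : 2 * (e%:R + 1) * th - th = 2 * (e%:R * th) + th); last by ring.
    rewrite (_ : 2 * e%:R * th - th = 2 * (e%:R * th) - th); last by ring.
    by rewrite sinD sinB; ring.
  rewrite -(big_mkord xpredT (fun e => sin (2 * e.+1%:R * th - th) - sin (2 * e%:R * th - th))).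
  rewrite telescope_sumr// mulr0 mul0r sub0r.
  rewrite (_ : 2 * E.+2%:R * th = pi *+ 2); last first.
    by rewrite /th mulr2n; field; rewrite -natrD pnatr_eq0.
  by rewrite [X in sin X - _]addrC sinD2pi subrr.
have cos2E (x : R) : cos x ^+ 2 = (1 + cos (2 * x)) / 2.
  by rewrite mulr_natl cos_mulr2n mulr2n; lra.
under eq_bigr do rewrite cos2E.
move: tele; rewrite -mulr_sumr => /eqP; rewrite mulf_eq0 mulf_eq0 pnatr_eq0 /= gt_eqF//= => /eqP e0.
rewrite -mulr_suml big_split /= e0 addr0 sumr_const card_ord ler_wpM2r ?invr_ge0//.
by rewrite lerDl.
Qed.

Lemma floor_natdiv (t K : nat) : (0 < K)%N ->
  Num.floor (t%:R / K%:R : R) = (t %/ K)%N%:Z.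
Proof.
move=> K0; apply: floor_def; have KR : (0 : R) < K%:R by rewrite ltr0n.
rewrite ler_pdivlMr// ltr_pdivrMr//.
rewrite -[X in (_ + X)]/(1%N%:Z) -PoszD -!pmulrn -!natrM ler_nat ltr_nat.
by rewrite leq_divM addn1 ltn_ceil.
Qed.

Lemma sum_epochs (F : nat -> R) (K E : nat) : (0 < K)%N ->
  \sum_(t < K * E) F (t %/ K)%N = K%:R * \sum_(e < E) F e.
Proof.
move=> K0; elim: E => [|E IH]; first by rewrite muln0 !big_ord0 mulr0.
rewrite mulnSr big_split_ord /= IH big_ord_recr mulrDr /=; congr (_ + _).
rewrite (eq_bigr (fun=> F E)) => [|i _]; first by rewrite sumr_const card_ord mulr_natl.
by rewrite mulnC divnMDl// divn_small// addn0.
Qed.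

Lemma K_epoch_gt0 (n b : nat) : (0 < n)%N -> (0 < b)%N -> (0 < K_epoch R n b)%N.
Proof.
move=> n0 b0; rewrite absz_gt0 gt_eqF// ceil_gt0 divr_gt0 ?ltr0n//.
Qed.

Lemma cos_schedule (m M : R) (n b E : nat) :
   0 <= m -> m <= M -> (0 < n)%N -> (0 < b)%N ->
   (0 < E)%N ->
   let K := K_epoch R n b in
   let T := (K * E)%N in
   B_T (eta_cos m M K E) T
     <= 2 / ((m + M) * T%:R) /\
   V_T (eta_cos m M K E) b T
     <= (3 * m ^+ 2 + 2 * m * M + 3 * M ^+ 2)
          / (4 * (m + M) * b%:R)
        + (M - m) * K%:R / (b%:R * T%:R).
Proof.
move=> m0 mM n0 b0 E0; have := K_epoch_gt0 n0 b0.
move: (K_epoch R n b) => K K0 /=.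
(* Midpoint and half-width of the range: in epoch [e] the rate is [s + c * cos (e pi / E)], and both
   bounds are proved in terms of [s] and [c]. *)
pose s := (m + M) / 2; pose c := (M - m) / 2.
pose F e := s + c * cos (e%:R * (pi / E%:R)).
have etaE t : eta_cos m M K E t = F (t %/ K)%N.
  by rewrite /eta_cos floor_natdiv// -pmulrn /F /s /c; field.
have ER : (0 : R) < E%:R by rewrite ltr0n.
have KR : (0 : R) < K%:R by rewrite ltr0n.
have bR : (0 : R) < b%:R by rewrite ltr0n.
rewrite /B_T /V_T.
have -> : \sum_(t < K * E) eta_cos m M K E t = K%:R * (E%:R * s + c).
  under eq_bigr do rewrite etaE.
  rewrite sum_epochs// /F big_split /= sumr_const card_ord -mulr_sumr.
  by rewrite sum_cos_epochs// mulr1 -[s *+ E]mulr_natl.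
set X := \sum_(e < E) cos (e%:R * (pi / E%:R)) ^+ 2 : R.
have -> : \sum_(t < K * E) eta_cos m M K E t ^+ 2 =
    K%:R * (E%:R * s ^+ 2 + 2 * s * c + c ^+ 2 * X).
  under eq_bigr do rewrite etaE.
  rewrite (sum_epochs (fun e => F e ^+ 2))// /F.
  rewrite (eq_bigr (fun e : 'I_E => s ^+ 2 + 2 * s * c * cos (e%:R * (pi / E%:R)) +
      c ^+ 2 * cos (e%:R * (pi / E%:R)) ^+ 2)) => [|e _]; last by ring.
  rewrite !big_split /= sumr_const card_ord -!mulr_sumr sum_cos_epochs// mulr1.
  by rewrite -[s ^+ 2 *+ E]mulr_natl.
have XE : X <= (E%:R + 1) / 2 by exact: sum_cos2_epochs.
have c0 : 0 <= c by rewrite divr_ge0// subr_ge0.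
have cs : c <= s by rewrite ler_wpM2r ?invr_ge0//; lra.
have -> : (m + M) = 2 * s by rewrite /s; field.
have -> : 3 * m ^+ 2 + 2 * m * M + 3 * M ^+ 2 = 8 * s ^+ 2 + 4 * c ^+ 2.
  by rewrite /s /c; field.
have -> : M - m = 2 * c by rewrite /c; field.
rewrite natrM.
(* Here [m = M = 0], and all sides vanish since the inverse of 0 is 0. *)
have [s0|sn0] := eqVneq s 0.
  have -> : c = 0 by apply/eqP; rewrite eq_le c0 andbT -s0.
  by rewrite s0 !(mulr0, mul0r, expr2, invr0, addr0).
have sp : 0 < s by rewrite lt_neqAle eq_sym sn0 (le_trans c0).
have dp : 0 < E%:R * s + c by rewrite ltr_pwDl// mulr_gt0.
split.
  have lp : 0 < 2 * s * (K%:R * E%:R) by rewrite mulr_gt0// mulr_gt0.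
  rewrite -[leRHS]invf_div lef_pV2 ?posrE ?divr_gt0 ?(mulr_gt0 KR)//.
  rewrite ler_pdivrMr//.
  have -> : K%:R * (E%:R * s + c) * 2 = 2 * s * (K%:R * E%:R) + 2 * (K%:R * c) by ring.
  by rewrite lerDl mulr_ge0// mulr_ge0// ltW.
rewrite ler_pdivrMr ?mulr_gt0//.
(* With denominators cleared, what remains is to absorb the excess [c ^+ 2 / 2] of [c ^+ 2 * X] over
   [c ^+ 2 * (E / 2)]; the term [s * c] does this because [c <= s]. *)
have -> : ((8 * s ^+ 2 + 4 * c ^+ 2) / (4 * (2 * s) * b%:R) +
    2 * c * K%:R / (b%:R * (K%:R * E%:R))) * (b%:R * (K%:R * (E%:R * s + c))) =
    K%:R * (E%:R * s ^+ 2 + 2 * s * c + c ^+ 2 * (E%:R / 2) +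
            (s * c + c ^+ 3 / (2 * s) + 2 * c ^+ 2 / E%:R)).
  by field; rewrite !gt_eqF.
rewrite ler_pM2l// -addrA -[leRHS]addrA -[leRHS]addrA lerD2l lerD2l.
have h1 : c ^+ 2 * X <= c ^+ 2 * ((E%:R + 1) / 2) by rewrite ler_wpM2l// sqr_ge0.
have h2 : c ^+ 2 <= s * c by rewrite expr2 ler_wpM2r.
have h3 : 0 <= c ^+ 3 / (2 * s) by apply: divr_ge0; [exact: exprn_ge0 | apply: mulr_ge0 => //; exact: ltW].
have h4 : 0 <= 2 * c ^+ 2 / E%:R by apply: divr_ge0; [apply: mulr_ge0 => //; exact: sqr_ge0 | exact: ltW].
have h5 : 0 <= c ^+ 2 by exact: sqr_ge0.
have h6 : c ^+ 2 * ((E%:R + 1) / 2) = c ^+ 2 * (E%:R / 2) + c ^+ 2 / 2 by field.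
move: h1 h2 h3 h4 h5; rewrite h6.
set u := c ^+ 2 * X; set v := c ^+ 2 * (_ / 2); set w := _ / (2 * s).
set x := 2 * c ^+ 2 / _; set y := s * c; set z := c ^+ 2; lra.
Qed.
End Trig.

(** * Power sums and the polynomial schedule *)

Section PowerSums.
Context (R : realType).
Implicit Types (a b q x : R).

Lemma powR_increment q a b : 0 < q -> 0 <= a -> a <= b ->
  (q + 1) * a `^ q * (b - a) <= b `^ (q + 1) - a `^ (q + 1)
    <= (q + 1) * b `^ q * (b - a).
Proof.
move=> q0 a0 ab; have b0 : 0 <= b by exact: le_trans ab.
have qn0 : q != 0 by rewrite gt_eqF.
have q1 : 0 < q + 1 by rewrite ltr_wpDl// ltW.
have q1n0 : q + 1 != 0 by rewrite gt_eqF.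
have powS x : 0 <= x -> x `^ (q + 1) = x `^ q * x.
  by move=> x0; rewrite powRD ?(negbTE q1n0)// powRr1.
move: a0; rewrite le_eqVlt => /predU1P[<-|a0].
  rewrite !powR0// mulr0 mul0r !subr0 powR_ge0/= powS// -mulrA.
  by rewrite ler_peMl ?mulr_ge0 ?powR_ge0//; lra.
have dpow x : 0 < x -> is_derive x 1 (fun y => y `^ (q + 1)) ((q + 1) * x `^ q).
  by move=> x0; have := is_derive1_powR (q + 1) x0; rewrite addrK.
have xab x : x \in `]a, b[ -> 0 < x.
  by rewrite in_itv => /andP[ax _]; exact: lt_trans ax.
have cpow : {within `[a, b], continuous (fun y => y `^ (q + 1))}.
  apply: derivable_within_continuous => x; rewrite in_itv => /andP[ax _].
  by have [] := dpow x (lt_le_trans a0 ax).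
have [c] := MVT_segment ab (fun x xI => dpow x (xab x xI)) cpow.
rewrite in_itv => /andP[ac cb] ->.
have c0 : 0 <= c by rewrite (le_trans _ ac)// ltW.
have mono x y : 0 <= x -> x <= y -> x `^ q <= y `^ q.
  move=> x0 xy; apply: ge0_ler_powR; rewrite ?nnegrE ?(ltW q0)//.
  exact: le_trans xy.
by rewrite !ler_wpM2r ?subr_ge0 ?ler_pM2l ?mono// ltW.
Qed.

Lemma sum_powR_bounds q (T : nat) : 0 < q -> (0 < T)%N ->
  T%:R / (q + 1) <= \sum_(t < T) (1 - t%:R / T%:R : R) `^ q <= T%:R / (q + 1) + 1.
Proof.
move=> q0 T0; have TR : (0 : R) < T%:R by rewrite ltr0n.
have q1 : 0 < q + 1 by rewrite ltr_wpDl// ltW.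
pose y (t : nat) : R := 1 - t%:R / T%:R.
have y0 : y 0%N = 1 by rewrite /y mul0r subr0.
have yT : y T = 0 by rewrite /y divff ?gt_eqF// subrr.
have yS t : y t - y t.+1 = T%:R^-1 by rewrite /y -natr1; field; rewrite gt_eqF.
have yge (t : nat) : (t <= T)%N -> 0 <= y t.
  by move=> tT; rewrite subr_ge0 ler_pdivrMr// mul1r ler_nat.
have ydec t : y t.+1 <= y t by rewrite -subr_ge0 yS invr_ge0.
have inc (t : 'I_T) : (q + 1) / T%:R * y t.+1 `^ q
    <= y t `^ (q + 1) - y t.+1 `^ (q + 1) <= (q + 1) / T%:R * y t `^ q.
  have := powR_increment q0 (yge _ (ltn_ord t)) (ydec t).
  by rewrite yS -!mulrA ![_ * T%:R^-1]mulrC.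
have tele : \sum_(t < T) (y t `^ (q + 1) - y t.+1 `^ (q + 1)) = 1.
  rewrite -(big_mkord xpredT (fun t => y t `^ (q + 1) - y t.+1 `^ (q + 1))).
  rewrite (telescope_sumr_eq (fun t => - y t `^ (q + 1)))// => [|t _].
    by rewrite y0 yT powR0 ?gt_eqF// powR1 oppr0 sub0r opprK.
  by rewrite opprK addrC.
have shift : \sum_(t < T) y t.+1 `^ q = \sum_(t < T) y t `^ q - 1.
  have := erefl (\sum_(t < T.+1) y t `^ q).
  rewrite {1}big_ord_recl big_ord_recr /= y0 yT powR1 powR0 ?gt_eqF//.
  rewrite addr0 => <-; rewrite addrC addKr.
  by apply: eq_bigr.
have le1 : 1 <= (q + 1) / T%:R * \sum_(t < T) y t `^ q.
  by rewrite -[leLHS]tele mulr_sumr ler_sum// => t _; case/andP: (inc t).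
have le2 : (q + 1) / T%:R * (\sum_(t < T) y t `^ q - 1) <= 1.
  by rewrite -shift -[leRHS]tele mulr_sumr ler_sum// => t _; case/andP: (inc t).
have e (S : R) : S = T%:R / (q + 1) * ((q + 1) / T%:R * S).
  by field; rewrite !gt_eqF.
have p0 : 0 <= T%:R / (q + 1) by rewrite divr_ge0// ltW.
apply/andP; split.
  by rewrite [leRHS]e -[leLHS]mulr1 ler_wpM2l.
by rewrite -lerBlDr [leLHS]e -[leRHS]mulr1 ler_wpM2l.
Qed.

(** The squared rate is a combination of powers with exponents [2 * p] and [p] and a constant, so
    [sum_powR_bounds] applies for both exponents: its lower bound to the denominator, its upper
    bounds to the numerator. *)
Lemma poly_schedule (m M p : R) (b T : nat) :
   0 < p -> 0 <= m -> m <= M -> (0 < b)%N -> (0 < T)%N ->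
   B_T (eta_poly m M p T) T
     <= (p + 1) / ((p * m + M) * T%:R) /\
   V_T (eta_poly m M p T) b T
     <= (2 * p ^+ 2 * m ^+ 2 + 2 * p * m * M
          + (p + 1) * M ^+ 2)
          / ((2 * p + 1) * (p * m + M) * b%:R)
        + (p + 1) * (M ^+ 2 - m ^+ 2)
          / ((p * m + M) * b%:R * T%:R).
Proof.
move=> p0 m0 mM b0 T0.
have TR : (0 : R) < T%:R by rewrite ltr0n.
have bR : (0 : R) < b%:R by rewrite ltr0n.
have p20 : 0 < 2 * p by rewrite mulr_gt0.
have /andP[S1 S1'] := sum_powR_bounds p0 T0.
have /andP[_ S2'] := sum_powR_bounds p20 T0.
set S := \sum_(t < T) _ `^ p in S1 S1'; set Q := \sum_(t < T) _ `^ (2 * p) in S2'.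
rewrite /B_T /V_T.
have -> : \sum_(t < T) eta_poly m M p T t = (M - m) * S + m * T%:R.
  by rewrite /eta_poly big_split /= -mulr_sumr sumr_const card_ord mulr_natr.
have -> : \sum_(t < T) eta_poly m M p T t ^+ 2 =
    (M - m) ^+ 2 * Q + 2 * m * (M - m) * S + m ^+ 2 * T%:R.
  rewrite (eq_bigr (fun t : 'I_T => (M - m) ^+ 2 * (1 - t%:R / T%:R) `^ (2 * p) +
      2 * m * (M - m) * (1 - t%:R / T%:R) `^ p + m ^+ 2)) => [|t _].
    by rewrite !big_split /= sumr_const card_ord -!mulr_sumr mulr_natr.
  by rewrite /eta_poly [2 * p]mulrC powRrM powR_mulrn ?powR_ge0//; ring.
(* Then [m = 0] as well, and all sides are 0 by the convention for the inverse of 0. *)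
have [M0|Mn0] := eqVneq M 0.
  have -> : m = 0 by apply/eqP; rewrite eq_le m0 andbT -M0.
  by rewrite M0 !(mulr0, mul0r, subr0, expr2, invr0, addr0).
have M0 : 0 < M by rewrite lt_neqAle eq_sym Mn0 (le_trans m0).
have D0 : 0 < p * m + M by rewrite ltr_wpDl// mulr_ge0// ltW.
have p1 : 0 < p + 1 by lra.
have p21 : 0 < 2 * p + 1 by lra.
have sumE : (M - m) * (T%:R / (p + 1)) + m * T%:R = (p * m + M) * T%:R / (p + 1).
  by field; rewrite gt_eqF.
have sum_ge : (p * m + M) * T%:R / (p + 1) <= (M - m) * S + m * T%:R.
  by rewrite -sumE lerD2r ler_wpM2l// subr_ge0.
have lb0 : 0 < (p * m + M) * T%:R / (p + 1) by rewrite divr_gt0// mulr_gt0.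
have inv_le : ((M - m) * S + m * T%:R)^-1 <= (p + 1) / ((p * m + M) * T%:R).
  by rewrite -[leRHS]invf_div lef_pV2// posrE (lt_le_trans lb0).
split=> //.
set N := (X in X / _ <= _).
have NU : N <= (M - m) ^+ 2 * (T%:R / (2 * p + 1) + 1) +
    2 * m * (M - m) * (T%:R / (p + 1) + 1) + m ^+ 2 * T%:R.
  by rewrite lerD2r lerD// ler_wpM2l ?sqr_ge0// !mulr_ge0// subr_ge0.
rewrite invfM mulrCA.
apply: le_trans (_ : b%:R^-1 * (((M - m) ^+ 2 * (T%:R / (2 * p + 1) + 1) +
    2 * m * (M - m) * (T%:R / (p + 1) + 1) + m ^+ 2 * T%:R) *
    ((p + 1) / ((p * m + M) * T%:R))) <= _).
  rewrite ler_wpM2l ?invr_ge0//; apply: ler_pM => //.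
    rewrite !addr_ge0 ?mulr_ge0 ?sqr_ge0 ?subr_ge0//.
    1,2: by apply: sumr_ge0 => t _; exact: powR_ge0.
  by rewrite invr_ge0 (le_trans _ sum_ge)// ltW.
(* An identity: the parts proportional to [T] give the first fraction, and the two [+ 1] give the
   second, as [(M - m) ^+ 2 + 2 * m * (M - m) = M ^+ 2 - m ^+ 2]. *)
rewrite le_eqVlt; apply/orP; left; apply/eqP; field.
by rewrite !gt_eqF.
Qed.
End PowerSums.

Unset Implicit Arguments.

Theorem theorem1 (R : realType) :
  (* main bound *)
  (forall (n d : nat) (fs : 'I_n -> 'rV[R]_d -> R)
     (gs : 'I_n -> 'rV[R]_d -> 'rV[R]_d) (L : 'I_n -> R)
     (dX : measure_display) (Xi : measurableType dX) (mu : probability Xi R)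
     (G : Xi -> 'rV[R]_d -> 'rV[R]_d) (sigma : R)
     (b : nat) (eta : nat -> R) (eta_min eta_max : R)
     (theta0 : 'rV[R]_d) (T : nat),
   (0 < n)%N ->
   (* (A1) *)
   (forall i x, differentiable (fs i) x /\
                forall v, 'd (fs i) x v = dotv (gs i x) v) ->
   (forall i, 0 < L i) ->
   (forall i x y, enorm (gs i x - gs i y) <= L i * enorm (x - y)) ->
   (forall i, has_lbound (range (fs i))) ->
   (* (A2): unbiased stochastic gradient with bounded variance *)
   (forall j : 'I_d, measurable_fun [set: Xi * d.-tuple R]
        (fun p => G p.1 (rv_of_tuple p.2) ord0 j)) ->
   (forall x (j : 'I_d),
        mu.-integrable [set: Xi] (fun xi => (G xi x ord0 j)%:E)) ->
   (forall x (j : 'I_d),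
        (\int[mu]_xi (G xi x ord0 j)%:E)%E = (avg_grad gs x ord0 j)%:E) ->
   0 <= sigma ->
   (forall x, (\int[mu]_xi (sqnorm (G xi x - avg_grad gs x))%:E
                 <= (sigma ^+ 2)%:E)%E) ->
   (* (A3) and the schedule *)
   (0 < b)%N ->
   (forall t, eta t.+1 <= eta t) ->
   (forall t, eta_min <= eta t <= eta_max) ->
   0 <= eta_min -> eta_max < 2 / avg_const L ->
   \sum_(t < T) eta t != 0 ->
   (\big[mine/+oo%E]_(t < T)
      sgd_expect mu b t
        (fun xi => (sqnorm (avg_grad gs (sgd_iter G eta b theta0 xi t)))%:E)
    <= ((2 * (avg_fun fs theta0 - avg_const (fun i => fstar (fs i))))
          / (2 - avg_const L * eta_max) * B_T eta T
        + avg_const L * sigma ^+ 2 / (2 - avg_const L * eta_max)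
          * V_T eta b T)%:E)%E)
  /\
  (* constant schedule *)
  (forall (eta_max : R) (b T : nat),
   0 <= eta_max -> (0 < b)%N -> (0 < T)%N ->
   B_T (eta_const eta_max) T <= (eta_max * T%:R)^-1 /\
   V_T (eta_const eta_max) b T <= eta_max / b%:R)
  /\
  (* diminishing schedule *)
  (forall (eta_max : R) (b T : nat),
   0 <= eta_max -> (0 < b)%N -> (0 < T)%N ->
   B_T (eta_dimin eta_max) T
     <= (2 * eta_max * (Num.sqrt (T.+1%:R) - 1))^-1 /\
   V_T (eta_dimin eta_max) b T
     <= eta_max * (1 + ln T%:R) / (2 * b%:R * (Num.sqrt (T.+1%:R) - 1)))
  /\
  (* cosine schedule, K = ceil(n/b), T = K E *)
  (forall (eta_min eta_max : R) (n b E : nat),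
   0 <= eta_min -> eta_min <= eta_max -> (0 < n)%N -> (0 < b)%N ->
   (0 < E)%N ->
   let K := K_epoch R n b in
   let T := (K * E)%N in
   B_T (eta_cos eta_min eta_max K E) T
     <= 2 / ((eta_min + eta_max) * T%:R) /\
   V_T (eta_cos eta_min eta_max K E) b T
     <= (3 * eta_min ^+ 2 + 2 * eta_min * eta_max + 3 * eta_max ^+ 2)
          / (4 * (eta_min + eta_max) * b%:R)
        + (eta_max - eta_min) * K%:R / (b%:R * T%:R))
  /\
  (* polynomial schedule *)
  (forall (eta_min eta_max p : R) (b T : nat),
   0 < p -> 0 <= eta_min -> eta_min <= eta_max -> (0 < b)%N -> (0 < T)%N ->
   B_T (eta_poly eta_min eta_max p T) T
     <= (p + 1) / ((p * eta_min + eta_max) * T%:R) /\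
   V_T (eta_poly eta_min eta_max p T) b T
     <= (2 * p ^+ 2 * eta_min ^+ 2 + 2 * p * eta_min * eta_max
          + (p + 1) * eta_max ^+ 2)
          / ((2 * p + 1) * (p * eta_min + eta_max) * b%:R)
        + (p + 1) * (eta_max ^+ 2 - eta_min ^+ 2)
          / ((p * eta_min + eta_max) * b%:R * T%:R)).
Proof.
split; last first.
  split; first exact: const_schedule.
  split; first exact: dimin_schedule.
  split; [exact: cos_schedule | exact: poly_schedule].
move=> n d fs gs L dX Xi mu G sigma b eta eta_min eta_max theta0 T n0 fsd L0 gsL
  fs_lb _ Gint Gmean _ Gvar b0 _ eta_bd emin0 emaxL S0.
exact: (min_sqnorm_bound n0 fsd L0 gsL fs_lb Gint Gmean Gvar b0 theta0 eta_bd).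
Qed.
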